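(* Let $\mathbf{A}$ be a finite algebra with an edge term. Then the following are equivalent: (1) Each $\mathbf{B} \in \mathbb{V}(\mathbf{A})$ is finitely based relative to $\mathbb{V}(\mathbf{A})$. (2) $\mathbb{V}(\mathbf{A})$ has only finitely many subvarieties. (3) $\mathbb{V}(\mathbf{A})$ contains, up to isomorphism, only finitely many cardinality critical members. (4) There is no infinite (strictly) descending chain of subvarieties of $\mathbb{V}(\mathbf{A})$.
   Context: An algebra is an algebraic structure of some fixed type, i.e. a set with operations interpreting a fixed set of finitary operation symbols. A variety is a class of algebras of a fixed type that consists of all algebras of this type satisfying some (possibly infinite) set of identities $s \approx t$, where $s,t$ are terms. For an algebra $\mathbf{A}$ (or a class $K$ of algebras of the same type), $\mathbb{V}(\mathbf{A})$ (resp. $\mathbb{V}(K)$) denotes the smallest variety containing $\mathbf{A}$ (resp. $K$). A subvariety of a variety $V$ is a variety (of the same type) contained in $V$. For $k \ge 2$, a function $t : A^{k+1} \to A$ is a $k$-edge operation if for all $x,y \in A$ we have $t(y,y,x,\ldots,x) = t(y,x,y,x,\ldots,x) = x$ and, for all $i \in \{4,\ldots,k+1\}$, $t(x,\ldots,x,y,x,\ldots,x) = x$ with $y$ in position $i$. An algebra has an edge term if, for some $k \ge 2$, one of its term functions is a $k$-edge operation. A variety $W$ contained in a variety $V$ is finitely based relative to $V$ if there is a finite set of identities $\Phi$ such that $W$ is the class of all algebras in $V$ that satisfy all identities in $\Phi$. An algebra $\mathbf{B} \in V$ is finitely based relative to $V$ if $\mathbb{V}(\mathbf{B})$ is finitely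 based relative to $V$. A finite algebra $\mathbf{B}$ is cardinality critical if it does not lie in the variety generated by the algebras $\mathbf{C} \in \mathbb{V}(\mathbf{B})$ with $|\mathbf{C}| < |\mathbf{B}|$. *)

(* Defs.v *)
From mathcomp Require Import all_boot.
From mathcomp Require Import boolp classical_sets functions cardinality.

Set Implicit Arguments.
Unset Strict Implicit.
Unset Printing Implicit Defensive.

Local Open Scope classical_set_scope.
Local Open Scope card_scope.

(* Any set of finitary operation symbols; nullary symbols are allowed. *)
Record signature : Type := Signature {
  symbol : Type;
  arity : symbol -> nat
}.

(* As usual in universal algebra, carriers are nonempty. *)
Record algebra (S : signature) : Type := Algebra {
  carrier :> Type;
  op : forall f : symbol S, ('I_(arity f) -> carrier) -> carrier;
  carrier_inhabited : inhabited carrier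
}.

Inductive term (S : signature) (X : Type) : Type :=
| Var of X
| App (f : symbol S) of ('I_(arity f) -> term S X).

Fixpoint eval (S : signature) (A : algebra S) (X : Type) (e : X -> A)
    (t : term S X) : A :=
  match t with
  | Var x => e x
  | App f ts => op (fun i => eval e (ts i))
  end.

Definition term_function (S : signature) (A : algebra S) (n : nat)
    (t : term S 'I_n) : ('I_n -> A) -> A :=
  fun e => eval e t.

(* Identities are written over the countable set of variables [nat]. *)
Definition identity (S : signature) : Type := (term S nat * term S nat)%type.

Definition satisfies (S : signature) (A : algebra S) (st : identity S) : Prop :=
  forall e : nat -> A, eval e st.1 = eval e st.2.

Definition models (S : signature) (Phi : set (identity S)) : set (algebra S) :=
  [set A | forall st, Phi st -> satisfies A st].

Definition is_variety (S : signature) : set (set (algebra S)) :=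
  [set V | exists Phi : set (identity S), V = models Phi].

Definition var_gen (S : signature) (K : set (algebra S)) : set (algebra S) :=
  smallest (@is_variety S) K.

Definition subvariety (S : signature) (V : set (algebra S)) :
    set (set (algebra S)) :=
  [set W | is_variety W /\ W `<=` V].

(* Positions are counted from 0, so the usual {1, 2}, {1, 3} and 4, ..., k + 1
   become {0, 1}, {0, 2} and 3, ..., k. *)
Definition edge_operation (A : Type) (k : nat) (t : ('I_k.+1 -> A) -> A) :
    Prop :=
  forall x y : A,
  [/\ t (fun j => if (j : nat) \in [:: 0; 1] then y else x) = x,
      t (fun j => if (j : nat) \in [:: 0; 2] then y else x) = x
    & forall i : 'I_k.+1, 3 <= i ->
        t (fun j => if j == i then y else x) = x].

Definition has_edge_term (S : signature) (A : algebra S) : Prop :=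
  exists2 k : nat, 2 <= k &
  exists t : term S 'I_k.+1, edge_operation (term_function (A := A) t).

Definition finite_algebra (S : signature) (A : algebra S) : Prop :=
  finite_set [set: A].

Definition rel_finitely_based (S : signature) (V W : set (algebra S)) : Prop :=
  exists2 Phi : set (identity S), finite_set Phi & W = V `&` models Phi.

Definition alg_rel_finitely_based (S : signature) (V : set (algebra S))
    (B : algebra S) : Prop :=
  rel_finitely_based V (var_gen [set B]).

Definition smaller (S : signature) (C B : algebra S) : Prop :=
  [set: C] #<= [set: B] /\ [set: C] #!= [set: B].

Definition cardinality_critical (S : signature) : set (algebra S) :=
  [set B | finite_algebra B /\
     ~ var_gen [set C | var_gen [set B] C /\ smaller C B] B].

Definition isomorphic (S : signature) (A B : algebra S) : Prop :=
  exists2 h : A -> B, bijective h &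
  forall (f : symbol S) (a : 'I_(arity f) -> A),
    h (op a) = op (fun i => h (a i)).

Definition finite_up_to_iso (S : signature) (K : set (algebra S)) : Prop :=
  exists F : set (algebra S),
  [/\ finite_set F, F `<=` K
    & forall B, K B -> exists2 C, F C & isomorphic B C].

Definition infinite_descending_chain (S : signature) (V : set (algebra S))
    (W : nat -> set (algebra S)) : Prop :=
  (forall n, subvariety V (W n)) /\ (forall n, W n.+1 `<` W n).

(* Main.v *)
Require Import Defs.
From mathcomp Require Import all_boot.
From mathcomp Require Import boolp classical_sets functions cardinality.
From mathcomp Require Import zify.

(** Write V for the variety generated by A. Since A is finite, V is locally
finite: modulo V there are finitely many terms in n variables, one for each
term function of A (table_of). So an algebra of V generated by n elements is
finite, and up to isomorphism there are finitely many of them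
(kernel_code_isomorphic). All implications but one rest on this alone.

- If there are finitely many subvarieties, there are finitely many critical
  members: two cardinality critical algebras generating the same variety have
  the same size, for otherwise the larger one would lie in the variety
  generated by the smaller one. So the sizes of the critical members are
  bounded, and V has finitely many members of bounded size.
- If there are finitely many critical members, there is no infinite descending
  chain: a subvariety is generated by its finite members, and each finite
  algebra lies in the variety generated by the critical algebras of the variety
  that it generates (finite_in_critical). So a subvariety is determined by a
  subset of a finite set of representatives of the critical members.
- If there is no infinite descending chain, each B in V is finitely based
  relative to V: the varieties defined inside V by the identities of B in at
  most n variables form a descending chain with intersection V(B). When it
  stabilizes, V(B) is defined by identities in n variables, which amount to
  finitely many modulo V.
- If each B in V is finitely based relative to V, there is no infinite
  descending chain: the intersection of a chain is V(B) for a single B, and the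
  finite relative base of B holds already in some member of the chain, by a
  compactness argument (chain_compact).

The edge term is needed to deduce from the descending chain condition that
there are finitely many subvarieties. It enters through finitely_determined:
each subvariety W has an n such that an identity, in any number of variables,
holds in W as soon as all those obtained from it by renaming its variables into
n variables hold in W. Granted this, a proper subvariety of W satisfies more
n-variable identities than W does. There are finitely many possible sets E of
n-variable identities modulo V, and for each E other than that of W the join J
of the subvarieties of W with set E has itself the set E, so J is proper. If W
has infinitely many subvarieties, then so does one of these finitely many
proper subvarieties J; iterating gives an infinite descending chain.

The pairs of term functions of A induced by the identities of W form a
clonoid: a family of functions from powers of A to A x A closed under the edge
operation and under identifying, permuting and adding variables.
So finitely_determined is a case of clonoid_finitely_related: a clonoid C from
a finite set to a finite algebra with an edge operation is determined by its
n-ary part for some n. Its proof combines two facts.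

- few_subpowers: if R is contained in S, both are sets of functions closed
  under a k-edge operation, and they have the same projections to fewer than k
  coordinates and the same forks, then R = S. A fork at a coordinate i is a
  pair of values at i of two functions that agree before i.
- finite_basis: the words over a finite alphabet are well-quasi-ordered by a
  refinement of the subword order (embeds), chosen such that a fork at a word b
  yields, by substituting variables, the same fork at each word a that embeds
  in b.

Take for S the functions all of whose n-ary minors lie in C. By finite_basis
the words where a given pair is not a fork of C are generated upwards by words
of length at most n, for n large. On words of length at most n, C and S
coincide, so they have the same forks; the projections agree for n large
because functions of too many variables can be restricted by identifying
variables with equal columns. So S = C. *)

Set Implicit Arguments.
Unset Strict Implicit.
Unset Printing Implicit Defensive.

Local Open Scope classical_set_scope.
Local Open Scope card_scope.

(** * Subpowers of an algebra with an edge operation *)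

(** Lists the arguments of an edge operation so that position [l.+2] receives
[c l]: the entry [c 0] takes part in the second edge identity, and each
later entry has a near-unanimity identity of its own. *)
Definition edge_args (E : Type) (a b : E) (c : nat -> E) (p : nat) : E :=
  match p with 0 => a | 1 => b | l.+2 => c l end.

Section EdgeFacts.
Variables (B : Type) (k : nat) (t : ('I_k.+1 -> B) -> B).
Hypothesis edge_t : edge_operation t.

Lemma edge_first (y x : B) (c : nat -> B) :
  (forall l, l < k.-1 -> c l = x) ->
  t (fun p => edge_args y y c p) = x.
Proof.
move=> cx; have [tE _ _] := edge_t x y; rewrite -[RHS]tE; congr (t _); apply/funext.
by case=> -[|[|p]] //= pk; rewrite cx //; lia.
Qed.

Lemma edge_second (y x : B) (c : nat -> B) :
  c 0 = y -> (forall l, 0 < l < k.-1 -> c l = x) ->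
  t (fun p => edge_args y x c p) = x.
Proof.
move=> c0 cx; have [_ tE _] := edge_t x y; rewrite -[RHS]tE; congr (t _); apply/funext.
by case=> -[|[|[|p]]] //= pk; rewrite cx //; lia.
Qed.

Lemma edge_later (x : B) (c : nat -> B) l0 :
  0 < l0 < k.-1 -> (forall l, l < k.-1 -> l != l0 -> c l = x) ->
  t (fun p => edge_args x x c p) = x.
Proof.
move=> l0k cx; have l0k' : l0.+2 < k.+1 by lia.
have [_ _ /(_ (Ordinal l0k'))] := edge_t x (c l0).
move=> /(_ ltac:(move=> /=; lia)) tE; rewrite -[RHS]tE; congr (t _); apply/funext.
move=> [p pk]; rewrite -val_eqE /=.
case: p pk => [|[|p]] pk //=; rewrite !eqSS.
by case: eqVneq => [->//|pl]; rewrite cx //; lia.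
Qed.

Lemma edge_idem (x : B) (c : nat -> B) :
  (forall l, l < k.-1 -> c l = x) -> t (fun p => edge_args x x c p) = x.
Proof. exact: edge_first. Qed.

End EdgeFacts.

Definition pointwise_closed (I B J : Type) (t : (J -> B) -> B)
    (R : set (I -> B)) : Prop :=
  forall F : J -> I -> B, (forall j, R (F j)) -> R (fun x => t (F ^~ x)).

(** [rank] orders the coordinates. Forks and small projections determine a
subpower, so the hypotheses [forks] and [projs] below, which bound those of
[S] by those of [R], force [S] into [R]. *)
Section FewSubpowers.
Variables (I : finType) (B : Type) (k : nat) (t : ('I_k.+1 -> B) -> B).
Hypotheses (k_ge2 : 2 <= k) (edge_t : edge_operation t).
Variables (rank : I -> nat) (R S : set (I -> B)).
Hypotheses (rank_inj : injective rank).
Hypotheses (RS : R `<=` S) (R_closed : pointwise_closed t R).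
Hypothesis forks : forall i f g, S f -> S g ->
  (forall x, rank x < rank i -> f x = g x) ->
  exists f' g', [/\ R f', R g', f' i = f i, g' i = g i &
    forall x, rank x < rank i -> f' x = g' x].
Hypothesis projs : forall f, S f -> forall X : seq I, size X < k ->
  exists2 r, R r & {in X, r =1 f}.

Let R_edge a b c : R a -> R b -> (forall l, l < k.-1 -> R (c l)) ->
  R (fun x => t (fun p => edge_args (a x) (b x) (c ^~ x) p)).
Proof.
move=> Ra Rb Rc.
rewrite (_ : (fun x => _) =
  fun x => t ((fun p : 'I_k.+1 => edge_args a b c p) ^~ x)).
  by apply: R_closed => -[[|[|p]] pk] //=; apply: Rc; lia.
by apply/funext => x; congr (t _); apply/funext => -[[|[|p]]].
Qed.

(** The heart of the matter: given [r0] in [R] that agrees with [f] before [i],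
find an element of [R] that agrees with [f] at [i] too, at least on [i :: X].
For small [X] this is a projection. Otherwise pick [k - 1] points [j l] of [X];
by induction there are [rho l] in [R] right on [i :: X] except at [j l]. The
near-unanimity identities repair the errors at [j l] for positive [l]. The two
other identities need, besides [rho 0], an [alpha] with the value of [rho 0] on
[X] and a [q] with the value of [f] on [X], both with the same value at [i].
Writing [b] for [f i] and [a] for [r0 i], the value t(b, a, b, ..., b) can be
reached by both: by [q] through an application of [t] to the [rho l] and [r0],
and by [alpha] because [(b, a)] is a fork of [R]. *)
Lemma extend_agreement f r0 i (X : seq I) : S f -> R r0 ->
  (forall x, rank x < rank i -> r0 x = f x) ->
  uniq X -> {in X, forall x, rank x < rank i} ->
  exists2 r, R r & {in i :: X, r =1 f}.
Proof.
move=> Sf Rr0 r0f; have [n] := ubnP (size X); elim: n X => // n IH X szX uX Xi.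
have [ltX|geX] := ltnP (size X) k.-1.
  by apply: (projs Sf) => /=; lia.
  (* There are at least [k.-1] entries, so the default [i] is never used. *)
pose j l := nth i X l.
have jX l : l < k.-1 -> j l \in X by move=> lk; apply/mem_nth/(leq_trans lk).
have j_inj l l' : l < k.-1 -> l' < k.-1 -> j l = j l' -> l = l'.
  by move=> hl hl' /eqP; rewrite nth_uniq ?(leq_trans _ geX) // => /eqP.
have rhoP l : exists r, l < k.-1 -> R r /\
    {in i :: X, forall x, x != j l -> r x = f x}.
  have [lk|] := ltnP l k.-1; last by exists r0.
  have [|||r Rr rf] := IH (rem (j l) X).
  - rewrite size_rem ?jX // prednK ?(leq_trans _ geX) //; exact: leq_ltn_trans lk.
  - exact: rem_uniq.
  - by move=> x /mem_rem /Xi.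
  exists r => _; split=> // x; rewrite inE => /orP[/eqP->|xX] xj.
    by apply: rf; rewrite mem_head.
  by apply: rf; rewrite inE mem_rem_uniq // !inE xj xX orbT.
have [rho {}rhoP] := choice rhoP.
have k0 : 0 < k.-1 by lia.
have Rrho l : l < k.-1 -> R (rho l) by move=> /rhoP[].
have rhof l x : l < k.-1 -> x \in i :: X -> x != j l -> rho l x = f x.
  by move=> /rhoP[_ h]; apply: h.
have rhoi l : l < k.-1 -> rho l i = f i.
  move=> lk; apply: rhof; rewrite ?mem_head //.
  by apply: contraTneq (Xi _ (jX _ lk)) => <-; rewrite ltnn.
have [h1 [h2 [Rh1 Rh2 h1i h2i h12]]] :=
  forks Sf (RS Rr0) (fun x lx => esym (r0f x lx)).
pose alpha x := t (fun p => edge_args (h1 x) (h2 x) (fun=> rho 0 x) p).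
have Ralpha : R alpha by apply: R_edge => // l _; apply: Rrho.
pose q x := t (fun p => edge_args (rho 0 x) (r0 x) (rho ^~ x) p).
have Rq : R q by apply: R_edge => //; apply: Rrho.
exists (fun x => t (fun p => edge_args (alpha x) (q x) (rho ^~ x) p)).
  exact: R_edge.
have alphaX x : x \in X -> alpha x = rho 0 x.
  by move=> /Xi xi; rewrite /alpha h12 //; apply: edge_first.
have alphai : alpha i = q i.
  rewrite /alpha /q h1i h2i !rhoi //; congr (t _); apply/funext.
  by move=> [[|[|p]] pk] //=; rewrite !rhoi //; lia.
move=> x; rewrite inE => /orP[/eqP->|xX].
  by rewrite alphai; apply: edge_first => // l; apply: rhoi.
have xi : rank x < rank i by apply: Xi.
have xiX : x \in i :: X by rewrite inE xX orbT.
rewrite alphaX //.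
have [/existsP[[l lk] /= /eqP xj]|/existsPn xj] :=
  boolP [exists l : 'I_k.-1, x == j l]; last first.
  have rx l : l < k.-1 -> rho l x = f x.
    by move=> lk; apply: rhof => //; apply: (xj (Ordinal lk)).
  have -> : q x = f x by rewrite /q r0f // rx //; apply: edge_idem.
  by rewrite rx //; apply: edge_idem.
have rx l' : l' < k.-1 -> l' != l -> rho l' x = f x.
  move=> lk' ll; apply: rhof => //; apply: contraNneq ll; rewrite xj => e.
  exact/eqP/esym/j_inj.
have [l0|l0] := posnP l.
  have qx : q x = f x.
    by rewrite /q r0f //; apply: edge_second => // l' /andP[h1' h2'];
       apply: rx => //; lia.
  by rewrite qx; apply: edge_second => // l' /andP[h1' h2']; apply: rx => //; lia.
have lk' : 0 < l < k.-1 by lia.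
have r0x : rho 0 x = f x by apply: rx => //; lia.
have qx : q x = f x by rewrite /q r0f // r0x; apply: (edge_later edge_t lk').
by rewrite qx r0x; apply: (edge_later edge_t lk').
Qed.

Lemma few_subpowers : S `<=` R.
Proof.
move=> f Sf; suff H N : exists2 r, R r & forall x, rank x < N -> r x = f x.
  have [r Rr rf] := H (\max_x rank x).+1.
  rewrite (_ : f = r) //; apply/funext => x; rewrite rf //.
  by rewrite ltnS; apply: leq_bigmax.
elim: N => [|N [r0 Rr0 r0f]].
  by have [|r Rr _] := projs Sf (X := [::]); [move=> /=; lia|exists r].
have [/existsP[i /eqP iN]|/existsPn noN] := boolP [exists i, rank i == N];
  last first.
  exists r0 => // x; rewrite ltnS leq_eqVlt => /orP[|/r0f//].
  by rewrite (negbTE (noN x)).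
have [|||r Rr rf] := extend_agreement Sf Rr0 (i := i)
  (X := [seq x <- enum I | rank x < rank i]).
- by rewrite iN.
- by rewrite filter_uniq // enum_uniq.
- by move=> x; rewrite mem_filter => /andP[].
exists r => // x; rewrite ltnS leq_eqVlt => /orP[/eqP xN|xN]; apply: rf.
  by rewrite (_ : x = i) ?mem_head //; apply: rank_inj; rewrite iN.
by rewrite inE mem_filter iN xN mem_enum orbT.
Qed.
End FewSubpowers.

(** * A well-quasi-order on words *)

Lemma infinite_pigeonhole (L : finType) (f : nat -> L) :
  exists c, forall n, exists2 m, n <= m & f m = c.
Proof.
apply: contrapT => /forallNP H.
have {}H c : exists n, forall m, n <= m -> f m <> c.
  have /existsNP[n nP] := H c; exists n => m nm fm.
  by apply: nP; exists m.
have [N NP] := choice H.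
by apply: (NP (f (\max_c N c)) (\max_c N c)) => //; apply: leq_bigmax.
Qed.

Definition bad (X : Type) (R : X -> X -> Prop) (f : nat -> X) : Prop :=
  forall i j, i < j -> ~ R (f i) (f j).

Lemma exists_min (X : Type) (P : X -> Prop) (mu : X -> nat) :
  (exists x, P x) -> exists2 x, P x & forall y, P y -> mu x <= mu y.
Proof.
move=> [x Px]; have [n] := ubnP (mu x); elim: n x Px => // n IH x Px xn.
have [[y [Py yx]]|noy] := pselect (exists y, P y /\ mu y < mu x).
  by apply: (IH y) => //; lia.
exists x => // y Py; rewrite leqNgt; apply/negP => yx.
by apply: noy; exists y.
Qed.

(** Nash-Williams: a bad sequence can be chosen such that no bad sequence with
the same first [n] terms has an [n]-th term of smaller measure. The terms are
fixed one after the other, each time replacing the whole sequence by one that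
is minimal at the next place. *)
Lemma minimal_bad (X : Type) (P : X -> Prop) (R : X -> X -> Prop)
    (mu : X -> nat) :
  (exists2 f, bad R f & forall i, P (f i)) ->
  exists f, [/\ bad R f, forall i, P (f i) &
    forall n g, bad R g -> (forall i, P (g i)) ->
      (forall i, i < n -> g i = f i) -> mu (f n) <= mu (g n)].
Proof.
move=> [f0 bf0 Pf0].
pose Q (f : nat -> X) := bad R f /\ forall i, P (f i).
have step n (f : {f | Q f}) : exists g : {f | Q f},
    (forall i, i < n -> sval g i = sval f i) /\
    forall h, Q h -> (forall i, i < n -> h i = sval f i) ->
      mu (sval g n) <= mu (h n).
  have [|g [Qg gf] gmin] := @exists_min (nat -> X)
    (fun g => Q g /\ forall i, i < n -> g i = sval f i) (fun g => mu (g n)).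
    by exists (sval f); split=> //; apply: (svalP f).
  by exists (exist _ g Qg); split=> // h Qh hf; apply: gmin.
have [next nextP] := choice (fun nf => step nf.1 nf.2).
pose G := fix G n := if n is m.+1 then next (m, G m) else exist Q f0 (conj bf0 Pf0).
have GP n m i : i < n -> sval (G (n + m)) i = sval (G n) i.
  move=> lin; elim: m => [|m IH]; rewrite ?addn0 // addnS /=.
  by rewrite (nextP (n + m, G (n + m))).1 //= ltn_addr.
pose f n := sval (G n.+1) n.
have fG n i : i < n -> f i = sval (G n) i.
  by move=> lin; rewrite -(subnKC lin) GP.
exists f; split=> [i j ij|i|n g bg Pg gf].
- by rewrite (fG j.+1 i) ?(fG j.+1 j) ?ltnS ?(ltnW ij) //; apply: (svalP (G j.+1)).1.
- exact: (svalP (G i.+1)).2.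
- apply: (nextP (n, G n)).2 => //= i lin; rewrite gf //; exact: fG.
Qed.

Section Embedding.
Variable T : finType.
Implicit Types a b : seq T.

(** The map [sigma] reads [b] off [a], and reaches the positions of [a] for the
first time in increasing order. This is what makes [c |-> c o sigma] strictly
monotone at [a] for the lexicographic order (embeds_select). *)
Definition embeds a b : Prop := exists sigma : nat -> nat,
  (forall j, j < size b -> sigma j < size a /\ onth b j = onth a (sigma j)) /\
  (forall p, p < size a -> exists j, [/\ j < size b, sigma j = p &
    forall j', j' < j -> sigma j' < p]).

Lemma embeds_nil : embeds [::] [::].
Proof. by exists id. Qed.

Lemma embeds_mem a b : embeds a b -> a =i b.
Proof.
move=> [s [s1 s2]] x; apply/idP/idP => /(nthP x)[].
  move=> p pa <-; have [j [jb <- _]] := s2 _ pa.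
  have [h1 h2] := s1 _ jb.
  by rewrite -odflt_onth -h2 odflt_onth mem_nth.
move=> j jb <-; have [h1 h2] := s1 _ jb.
by rewrite -odflt_onth h2 odflt_onth mem_nth.
Qed.

Lemma onth_rcons a x i :
  onth (rcons a x) i = if i == size a then Some x else onth a i.
Proof.
elim: a i => [|y a IH] [|i] //=; rewrite ?IH ?eqSS //.
by rewrite /onth /=; case: i.
Qed.

(** The last letters become partners; the position of the new letter of [a] is
reached last, after all others. *)
Lemma embeds_rcons2 a b x : embeds a b -> embeds (rcons a x) (rcons b x).
Proof.
move=> [s [s1 s2]]; exists (fun j => if j == size b then size a else s j).
rewrite !size_rcons; split=> [j|p].
  rewrite ltnS leq_eqVlt !onth_rcons; case: eqVneq => [_ _|jb /= /s1[h1 h2]].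
    by rewrite ltnS leqnn eqxx.
  by rewrite ltnS ltnW // h2; case: eqVneq h1 => [->|//]; rewrite ltnn.
rewrite ltnS leq_eqVlt => /orP[/eqP->|/s2[j [jb sj jP]]].
  exists (size b); rewrite ltnSn eqxx; split=> // j' jb.
  by rewrite (ltn_eqF jb); have [] := s1 _ jb.
exists j; rewrite ltnS (ltnW jb) (ltn_eqF jb); split=> // j' jj.
by rewrite (ltn_eqF (ltn_trans jj jb)); apply: jP.
Qed.

(** A letter that occurs in [a] can be read off its old position, which is
already reached, so the order of first visits is unchanged. *)
Lemma embeds_rcons a b x : x \in a -> embeds a b -> embeds a (rcons b x).
Proof.
move=> xa [s [s1 s2]]; exists (fun j => if j == size b then index x a else s j).
rewrite size_rcons; split=> [j|p].
  rewrite ltnS leq_eqVlt !onth_rcons; case: eqVneq => [_ _|jb /= /s1//].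
  by rewrite index_mem xa (onthE) (nth_map x) ?index_mem // nth_index.
move=> /s2[j [jb sj jP]].
exists j; rewrite ltnS (ltnW jb) (ltn_eqF jb); split=> // j' jj.
by rewrite (ltn_eqF (ltn_trans jj jb)); apply: jP.
Qed.

(** Induction on the number of letters that a word may use. In a minimal bad
sequence infinitely many words end in the same letter [x]; let [u] be these
words without their last letter. If [x] occurs in none of the [u], they use one
letter less and the induction hypothesis applies. If [x] occurs in all of them,
splicing the [u] into the sequence contradicts minimality: a word embedding
in some [u] contains [x], hence embeds in [u] followed by [x]. *)
Lemma embeds_wqo_letters d (f : nat -> seq T) :
  (forall i, size (undup (f i)) <= d) -> ~ bad embeds f.
Proof.
elim: d f => [|d IHd] f fd bf.
  have f0 i : f i = [::] by have := fd i; rewrite leqn0 => /nilP/undup_nil.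
  by apply: (bf 0 1) => //; rewrite !f0; apply: embeds_nil.
have [w [bw wd wmin]] := @minimal_bad (seq T) (fun s => size (undup s) <= d.+1)
  embeds size (ex_intro2 _ _ f bf fd).
pose u i := rev (behead (rev (w i))).
pose label i : option (T * bool) :=
  if rev (w i) is x :: s then Some (x, x \in s) else None.
have wE i x c : label i = Some (x, c) -> w i = rcons (u i) x /\ c = (x \in u i).
  rewrite /label /u; case E: (rev (w i)) => [//|y s] [<- <-] /=.
  by rewrite -[w i]revK E rev_cons mem_rev.
have [c cP] := infinite_pigeonhole label.
have [next nextP] := choice (fun n => let: ex_intro2 m a b := cP n in ex_intro
  (fun m => n <= m /\ label m = c) m (conj a b)).
pose phi := fix phi n := if n is m.+1 then next (phi m).+1 else next 0.
have phic n : label (phi n) = c by case: n => [|n]; apply: (nextP _).2.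
have phi_lt i j : i < j -> phi i < phi j.
  move=> ij; have -> : j = i.+1 + (j - i.+1) by lia.
  elim: (j - i.+1) => [|m IH]; first by rewrite addn0; apply: (nextP _).1.
  by rewrite addnS; apply: (leq_trans IH); apply: ltnW; apply: (nextP _).1.
case: c {cP next nextP} phi phic phi_lt => [[x []]|] phi phic phi_lt; last first.
- have wnil n : w (phi n) = [::].
    by have := phic n; rewrite /label; case E: (rev _) => // _; rewrite -[w _]revK E.
  by apply: (bw (phi 0) (phi 1)); rewrite ?phi_lt // !wnil; apply: embeds_nil.
- have wx n := wE _ _ _ (phic n).
  apply: (IHd (u \o phi)) => [n|i j ij uu] /=.
    have := wd (phi n); have [-> xu] := wx n.
    by rewrite undup_rcons size_rcons ltnS => /(leq_trans _); apply;
       rewrite (all_filterP _) //; apply/allP => y; rewrite mem_undup;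
       apply: contraTneq => ->; rewrite -xu.
  apply: (bw _ _ (phi_lt _ _ ij)).
  by have [-> _] := wx i; have [-> _] := wx j; apply: embeds_rcons2.
have wx n := wE _ _ _ (phic n).
(* The words [u] replace the tail of [w] that starts at [phi 0]. *)
pose g i := if i < phi 0 then w i else u (phi (i - phi 0)).
have := wmin (phi 0) g; rewrite /g ltnn subnn.
have [-> _] := wx 0; rewrite size_rcons ltnn => H.
suff: false by []; apply: H => [i j ij|i|i ->//].
  case: ltnP => i0; case: ltnP => j0; [exact: bw| |lia|] => e.
    apply: (bw i (phi (j - phi 0))) => //.
      have [->|j1] := posnP (j - phi 0) => //.
      by apply: (ltn_trans i0); apply: phi_lt.
    have [-> xu] := wx (j - phi 0); apply: embeds_rcons => //.
    by rewrite (embeds_mem e) -xu.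
  apply: (bw (phi (i - phi 0)) (phi (j - phi 0))); first by apply: phi_lt; lia.
  have [-> _] := wx (i - phi 0); have [-> _] := wx (j - phi 0).
  exact: embeds_rcons2.
case: ltnP => // i0; have := wd (phi (i - phi 0)); apply: leq_trans.
have [-> _] := wx (i - phi 0).
apply: uniq_leq_size; first exact: undup_uniq.
by move=> y; rewrite !mem_undup mem_rcons inE => ->; rewrite orbT.
Qed.

(** If no length bound were sufficient, picking again and again an element of [U]
in which no shorter one embeds would produce a bad sequence. *)
Lemma finite_basis (U : set (seq T)) :
  exists n, forall b, U b -> exists a, [/\ U a, size a <= n & embeds a b].
Proof.
apply: contrapT => /forallNP H.
have {}H n : exists b, U b /\ forall a, U a -> size a <= n -> ~ embeds a b.
  have /existsNP[b /not_implyP[Ub nb]] := H n; exists b; split=> // a Ua an ab.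
  by apply: nb; exists a.
have [beta betaP] := choice H.
pose N := fix N i := if i is j.+1 then maxn (N j) (size (beta (N j))) else 0.
apply: (@embeds_wqo_letters #|T| (beta \o N)) => [i|i j ij] /=.
  by rewrite -(card_uniqP _) ?undup_uniq // max_card.
apply: (betaP (N j)).2; first exact: (betaP (N i)).1.
have -> : j = i.+1 + (j - i.+1) by lia.
elim: (j - i.+1) => [|m IH]; first by rewrite addn0 /= leq_max leqnn orbT.
by rewrite addnS /= leq_max IH.
Qed.
End Embedding.

(** * Clonoids *)

Section Lex.
Variables (l m : nat).
Implicit Types c w : m.-tuple 'I_l.

Definition lex c w : Prop :=
  exists2 p : 'I_m, tnth c p < tnth w p &
    forall q : 'I_m, q < p -> tnth c q = tnth w q.

Lemma lex_irr w : ~ lex w w.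
Proof. by case=> p; rewrite ltnn. Qed.

Lemma lex_trans w1 w2 w3 : lex w1 w2 -> lex w2 w3 -> lex w1 w3.
Proof.
move=> [p ltp eqp] [q ltq eqq]; case: (ltngtP p q) => [pq|qp|/val_inj pq].
- exists p => [|r rp]; first by rewrite -(eqq _ pq).
  by rewrite eqp // eqq // (ltn_trans rp).
- exists q => [|r rq]; first by rewrite (eqp _ qp).
  by rewrite eqp ?eqq // (ltn_trans rq).
- by subst q; exists p => [|r rp]; [exact: ltn_trans ltq|rewrite eqp ?eqq].
Qed.

Lemma lex_total c w : c <> w -> lex c w \/ lex w c.
Proof.
move=> cw; have [|p pP pmin] := @exists_min 'I_m
    (fun p => tnth c p <> tnth w p) (@nat_of_ord m).
  by apply: contrapT => /forallNP H; apply/cw/eq_from_tnth => i;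
     apply: contrapT; apply: H.
have eqp (q : 'I_m) : q < p -> tnth c q = tnth w q.
  by move=> qp; apply: contrapT => /pmin; rewrite leqNgt qp.
case: (ltngtP (tnth c p) (tnth w p)) => [cp|cp|/val_inj//].
  by left; exists p.
by right; exists p => // q /eqp.
Qed.

(** Turns the lexicographic order into the numerical ranking that few_subpowers
works with. *)
Definition lex_rank w : nat := #|[pred c | `[< lex c w >]]|.

Lemma lex_rank_lt c w : lex c w -> lex_rank c < lex_rank w.
Proof.
move=> cw; apply/proper_card/properP; split.
  apply/fintype.subsetP => d dc; apply/asboolP; apply: lex_trans cw.
  exact/asboolP.
by exists c; [|apply/negP]; [apply/asboolP|move=> /asboolP/lex_irr].
Qed.

Lemma lex_rankP c w : lex_rank c < lex_rank w -> lex c w.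
Proof.
move=> cw; have [e|/eqP/lex_total[//|/lex_rank_lt wc]] := eqVneq c w.
  by rewrite e ltnn in cw.
by have := ltn_trans cw wc; rewrite ltnn.
Qed.

Lemma lex_rank_inj : injective lex_rank.
Proof.
move=> c w e; have [//|/eqP/lex_total] := eqVneq c w.
by case=> /lex_rank_lt; rewrite e ltnn.
Qed.
End Lex.

(** Precomposing with [select s] is substituting the variable [s i] for the
[i]-th one, that is, forming a minor. *)
Definition select (T : Type) (m n : nat) (s : 'I_m -> 'I_n)
    (w : n.-tuple T) : m.-tuple T := [tuple tnth w (s i) | i < m].

Lemma select_comp (T : Type) m n p (s : 'I_m -> 'I_n) (r : 'I_n -> 'I_p)
  (w : p.-tuple T) : select s (select r w) = select (r \o s) w.
Proof. by apply: eq_from_tnth => i; rewrite !tnth_mktuple. Qed.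

Lemma embeds_select l m n (a : m.-tuple 'I_l) (b : n.-tuple 'I_l) :
  embeds a b -> exists s : 'I_n -> 'I_m,
    b = select s a /\ forall c, lex c a -> lex (select s c) b.
Proof.
case=> s [s1 s2]; have sm (j : 'I_n) : s j < m.
  by have [] := s1 j; rewrite !size_tuple.
have bE : b = select (fun j => Ordinal (sm j)) a.
  apply: eq_from_tnth => j; have x0 := tnth b j.
  rewrite tnth_mktuple !(tnth_nth x0) /=.
  by have [] := s1 j; rewrite !size_tuple // -!odflt_onth => _ <-.
exists (fun j => Ordinal (sm j)); split=> // c [p cp eqp].
have [] := s2 p; rewrite !size_tuple // => j [jn sj jP].
have sjE : Ordinal (sm (Ordinal jn)) = p by apply: val_inj.
exists (Ordinal jn); first by rewrite bE !tnth_mktuple sjE.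
by move=> q qj; rewrite bE !tnth_mktuple eqp //=; apply: jP.
Qed.

Record clonoid (l k : nat) (B : Type) (t : ('I_k.+1 -> B) -> B)
    (C : forall m, set (m.-tuple 'I_l -> B)) : Prop := Clonoid {
  clonoid_closed : forall m, pointwise_closed t (C m);
  clonoid_minor : forall m n (s : 'I_m -> 'I_n) f,
    C m f -> C n (f \o select s) }.

Lemma finite_range (T : Type) (F : set T) :
  finite_set F -> exists n (d : 'I_n -> T), F = range d.
Proof.
elim/Pchoice: T => T in F *; case/finite_seqP => s ->.
exists (size s), (tnth (in_tuple s)); apply/seteqP; split=> [x|_ [i _ <-]] /=.
  by move=> /(tnthP (in_tuple s))[i ->]; exists i.
exact: mem_tnth.
Qed.

Lemma finite_uniform (T : Type) (F : set T) (P : T -> nat -> Prop) :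
  finite_set F -> (forall x n m, n <= m -> P x n -> P x m) ->
  (forall x, F x -> exists n, P x n) -> exists n, forall x, F x -> P x n.
Proof.
move=> /finite_range[N [d ->]] Pmono PF.
have [g gP] := choice (fun i => PF (d i) (imageT d i)).
exists (\max_i g i) => _ [i _ <-]; apply: Pmono (gP i); exact: leq_bigmax.
Qed.

Section ClonoidTheorem.
Variables (l k : nat) (B : Type) (t : ('I_k.+1 -> B) -> B).
Variable C : forall m, set (m.-tuple 'I_l -> B).
Arguments C : clear implicits.
Hypotheses (l_gt0 : 0 < l) (k_ge2 : 2 <= k) (edge_t : edge_operation t).
Hypotheses (finB : finite_set [set: B]) (CC : clonoid t C).

(** The functions that the [n]-ary part of [C] cannot tell from members of [C].
*)
Let minors n m : set (m.-tuple 'I_l -> B) :=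
  [set f : m.-tuple 'I_l -> B | forall s : 'I_m -> 'I_n, C n (f \o select s)].
Arguments minors : clear implicits.

Let C_minors n m : C m `<=` minors n m.
Proof. by move=> f Cf s; exact: (clonoid_minor CC). Qed.

Let minors_minor n m p f (s : 'I_m -> 'I_p) :
  minors n m f -> minors n p (f \o select s).
Proof.
move=> mf r; have := mf (r \o s); congr (C _).
by apply/funext => w /=; rewrite select_comp.
Qed.

(** For [m <= n] the variables can be renamed injectively into [n] variables and
back. The arity 0 is excluded since there is no way back to it. *)
Let minors_low n m : 0 < m <= n -> minors n m `<=` C m.
Proof.
case: m => // m /= mn f /(_ (widen_ord mn)) /(clonoid_minor CC (@inord m \o val)).
congr (C _ _); apply/funext => w /=; rewrite select_comp; congr (f _).
apply: eq_from_tnth => i; rewrite tnth_mktuple; congr (tnth _ _).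
by apply: val_inj; rewrite /= inordK.
Qed.

Definition fork m (f g : m.-tuple 'I_l -> B) w u v : Prop :=
  [/\ f w = u, g w = v & forall c, lex c w -> f c = g c].

Definition forked (s : seq 'I_l) (uv : B * B) : Prop :=
  exists m (w : m.-tuple 'I_l) f g,
    [/\ tval w = s, C m f, C m g & fork f g w uv.1 uv.2].

Let forkedP m (w : m.-tuple 'I_l) uv : forked w uv ->
  exists f g, [/\ C m f, C m g & fork f g w uv.1 uv.2].
Proof.
case=> n [w' [f [g [ww' Cf Cg fg]]]].
have mn : n = m by rewrite -(size_tuple w') ww' size_tuple.
by subst n; move/val_inj: ww' fg => -> fg; exists f, g.
Qed.

(** Suppose that [(u, v)] is not a fork of [C] at [w]. Then it is not one at some
short word [a] that embeds in [w]. The embedding turns a fork of the minors at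
[w] into a fork at [a] of functions of arity [size a], which belong to [C]. *)
Let minors_forked : exists n0, forall n, n0 <= n ->
  forall m (w : m.-tuple 'I_l) f g u v, 0 < m ->
  minors n m f -> minors n m g -> fork f g w u v -> forked w (u, v).
Proof.
have [|||n0 n0P] := @finite_uniform _ [set: B * B] (fun uv n =>
  forall b, ~ forked b uv ->
    exists a, [/\ ~ forked a uv, size a <= n & embeds a b]).
- by rewrite -setXTT; apply: finite_setX.
- move=> uv n m nm nP b /nP[a [? an ?]]; exists a; split=> //; exact: leq_trans nm.
- by move=> uv _; apply: (finite_basis [set b | ~ forked b uv]).
exists n0 => n n0n m w f g u v m0 mf mg [fu gv fg].
apply: contrapT => /(n0P (u, v) I)[a [na an aw]]; apply: na.
have [s [ws sP]] := embeds_select (a := in_tuple a) aw.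
have ia : 0 < size a <= n.
  by rewrite (leq_trans an) // andbT; apply: leq_trans (ltn_ord (s (Ordinal m0))).
exists (size a), (in_tuple a), (f \o select s), (g \o select s); split=> //.
- by apply: (minors_low ia); apply: minors_minor.
- by apply: (minors_low ia); apply: minors_minor.
- by split=> [||c ca] /=; rewrite -?ws // fg //; apply: sP.
Qed.

(** The variables with the same column of entries in the words of [X] can be
identified without affecting the values on [X]. At most [l ^ k.-1] variables
remain, so the resulting minor is in [C], and it can be inflated back to
arity [m]. *)
Let minors_proj n m f (X : seq (m.-tuple 'I_l)) : 0 < m ->
  l ^ k.-1 <= n -> size X < k -> minors n m f ->
  exists2 r, C m r & {in X, r =1 f}.
Proof.
move=> m0 ln Xk mf.
pose col (i : 'I_m) : (size X).-tuple 'I_l :=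
    [tuple tnth (tnth (in_tuple X) p) i | p < size X].
have le : #|{: (size X).-tuple 'I_l}| <= n.
  rewrite card_tuple card_ord (leq_trans _ ln) // leq_pexp2l //; lia.
pose s (i : 'I_m) : 'I_n := widen_ord le (enum_rank (col i)).
pose h (j : 'I_n) : 'I_m := odflt (Ordinal m0) [pick i | s i == j].
exists ((f \o select s) \o select h); first exact/(clonoid_minor CC)/mf.
move=> w wX /=; rewrite select_comp; congr (f _).
apply: eq_from_tnth => i; rewrite tnth_mktuple /= /h.
case: pickP => [j /eqP /= /(congr1 val) /= /val_inj /enum_rank_inj cij|].
  have /(tnthP (in_tuple X))[p ->] := wX.
  by have := congr1 (fun c => tnth c p) cij; rewrite !tnth_mktuple.
by move=> /(_ i); rewrite eqxx.
Qed.

(** For [n] large, [C] and [minors n] have the same forks and the same projections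
to fewer than [k] coordinates. *)
Theorem clonoid_finitely_related : exists n, forall m f, 0 < m ->
  (forall s : 'I_m -> 'I_n, C n (f \o select s)) -> C m f.
Proof.
have [n0 n0P] := minors_forked.
pose n := maxn n0 (l ^ k.-1); exists n => m f m0 mf.
have n0n : n0 <= n by rewrite leq_maxl.
have ln : l ^ k.-1 <= n by rewrite leq_maxr.
apply: (@few_subpowers _ _ _ _ k_ge2 edge_t (@lex_rank l m) (C m)
  (minors n m)) => //.
- exact: lex_rank_inj.
- exact: C_minors.
- exact: clonoid_closed.
- move=> w f' g' mf' mg' fg.
  have := n0P _ n0n m w f' g' (f' w) (g' w) m0 mf' mg'.
  case/(_ _)/forkedP => [|f1 [g1 [Cf Cg [/= f1w g1w fg1]]]].
    by split=> // c /lex_rank_lt/fg.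
  by exists f1, g1; split=> // c /lex_rankP/fg1.
- by move=> f' mf' X Xk; apply: minors_proj mf'.
Qed.
End ClonoidTheorem.

(** * Terms, identities and varieties *)

Section Terms.
Variable S : signature.

Fixpoint subst X Y (g : X -> term S Y) (t : term S X) : term S Y :=
  match t with
  | Var x => g x
  | App f ts => App (fun i => subst g (ts i))
  end.

Definition rename X Y (g : X -> Y) : term S X -> term S Y :=
  subst (fun x => Var S (g x)).

Lemma eval_subst (A : algebra S) X Y (g : X -> term S Y) (e : Y -> A) t :
  eval e (subst g t) = eval (fun x => eval e (g x)) t.
Proof. by elim: t => //= f ts IH; congr (op _); apply/funext. Qed.

Lemma eval_rename (A : algebra S) X Y (g : X -> Y) (e : Y -> A) t :
  eval e (rename g t) = eval (e \o g) t.
Proof. exact: eval_subst. Qed.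

Lemma rename_comp X Y Z (g : X -> Y) (h : Y -> Z) (t : term S X) :
  rename h (rename g t) = rename (h \o g) t.
Proof. by elim: t => //= f ts IH; rewrite /rename /=; congr App; apply/funext. Qed.

Definition holds (K : set (algebra S)) X (s t : term S X) : Prop :=
  forall B, K B -> forall e : X -> B, eval e s = eval e t.

Lemma holds_sub (K L : set (algebra S)) X (s t : term S X) :
  K `<=` L -> holds L s t -> holds K s t.
Proof. by move=> KL h B /KL/h. Qed.

Lemma holds_subst (K : set (algebra S)) X Y (g : X -> term S Y) s t :
  holds K s t -> holds K (subst g s) (subst g t).
Proof. by move=> h B KB e; rewrite !eval_subst; apply: h. Qed.

Lemma holds_rename (K : set (algebra S)) X Y (g : X -> Y) s t :
  holds K s t -> holds K (rename g s) (rename g t).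
Proof. exact: holds_subst. Qed.

(** Carriers are nonempty, so an assignment of the variables in the image of [g]
extends to all variables. *)
Lemma holds_rename_inj (K : set (algebra S)) X Y (g : X -> Y) s t :
  injective g -> holds K (rename g s) (rename g t) -> holds K s t.
Proof.
move=> ginj h B KB e; have [b0] := carrier_inhabited B.
pose e' y := if pselect (exists x, g x = y) is left p then e (projT1 (cid p)) else b0.
have -> : e = e' \o g.
  apply/funext => x; rewrite /e' /=; case: pselect => [p|[]]; last by exists x.
  by case: cid => z /= /ginj ->.
by have := h B KB e'; rewrite !eval_rename.
Qed.

Definition theory (K : set (algebra S)) : set (identity S) :=
  [set st | holds K st.1 st.2].

Lemma var_genE (K : set (algebra S)) : var_gen K = models (theory K).
Proof.
apply/seteqP; split=> B.
  move=> h; apply: (h (models (theory K))); split; first by exists (theory K).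
  by move=> C KC st; apply.
move=> hB V [[Phi ->] KV] st Phist; apply: hB => C /KV h; exact: h st Phist.
Qed.

Lemma is_variety_var_gen (K : set (algebra S)) : is_variety (var_gen K).
Proof. by rewrite var_genE; exists (theory K). Qed.

Lemma sub_var_gen (K : set (algebra S)) : K `<=` var_gen K.
Proof. exact: sub_gen_smallest. Qed.

Lemma var_gen_sub (K V : set (algebra S)) :
  is_variety V -> K `<=` V -> var_gen K `<=` V.
Proof. by move=> vV KV; apply: smallest_sub. Qed.

Lemma theory_sub (V W : set (algebra S)) : is_variety W ->
  (theory W `<=` theory V) -> V `<=` W.
Proof.
by case=> Phi -> WV B VB st Phist e; apply: (WV st) VB e => C /(_ st Phist); apply.
Qed.

Lemma finite_vars (t : term S nat) : exists n, forall m, n <= m ->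
  rename (fun i => val (inord i : 'I_m.+1)) t = t.
Proof.
elim: t => [x|f ts IH].
  by exists x => m xm; rewrite /rename /= inordK.
have [g gP] := choice IH; exists (\max_i g i) => m gm.
rewrite /rename /=; congr App; apply/funext => i; apply: gP.
by apply: leq_trans gm; apply: leq_bigmax.
Qed.

Lemma finite_vars2 (st : identity S) : exists n (s t : term S 'I_n.+1),
  st = (rename val s, rename val t).
Proof.
case: st => s t; have [n nP] := finite_vars s; have [m mP] := finite_vars t.
exists (maxn n m), (rename inord s), (rename inord t).
by rewrite !rename_comp nP ?mP ?leq_maxl ?leq_maxr.
Qed.

Definition theory_from n (K : set (algebra S)) : set (identity S) :=
  [set st | exists2 uv : term S 'I_n.+1 * term S 'I_n.+1, holds K uv.1 uv.2 &
    st = (rename val uv.1, rename val uv.2)].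

Lemma holds_val K n (s t : term S 'I_n) :
  holds K (rename val s) (rename val t) <-> holds K s t.
Proof. by split; [apply/holds_rename_inj/val_inj|apply: holds_rename]. Qed.

Lemma fintheory_sub (V W : set (algebra S)) : is_variety W ->
  (forall n (s t : term S 'I_n.+1), holds W s t -> holds V s t) -> V `<=` W.
Proof.
move=> vW WV; apply: theory_sub => // st; have [n [s [t ->]]] := finite_vars2 st.
by rewrite /theory /= !holds_val; apply: WV.
Qed.

Lemma holds_var_gen (K : set (algebra S)) n (s t : term S 'I_n) :
  holds K s t -> holds (var_gen K) s t.
Proof.
move=> /holds_val h; apply/holds_val => B; rewrite var_genE.
by move=> /(_ (_, _) h); apply.
Qed.

Lemma is_varietyI (V : set (algebra S)) Phi :
  is_variety V -> is_variety (V `&` models Phi).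
Proof.
case=> Psi ->; exists (Psi `|` Phi); apply/seteqP; split=> B.
  by case=> h1 h2 st [/h1|/h2].
by move=> h; split=> st p; apply: h; [left|right].
Qed.

Lemma is_variety_bigcap (J : Type) (V : J -> set (algebra S)) :
  (forall i, is_variety (V i)) -> is_variety (\bigcap_i V i).
Proof.
move=> /choice[Phi PhiP]; exists (\bigcup_i Phi i); apply/seteqP; split=> B.
  by move=> VB st [i _ Phist]; have := VB i I; rewrite PhiP; apply.
by move=> h i _; rewrite PhiP => st Phist; apply: h; exists i.
Qed.

Definition subalgebra_carrier (B : algebra S) X (e : X -> B) :=
  {b : B | exists t : term S X, b = eval e t}.

Lemma generated_closed (B : algebra S) X (e : X -> B) (f : symbol S)
    (a : 'I_(arity f) -> subalgebra_carrier e) :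
  exists t : term S X, op (fun i => sval (a i)) = eval e t.
Proof.
have [ts tsP] := choice (fun i => svalP (a i)).
by exists (App ts) => /=; congr (op _); apply/funext.
Qed.

Definition generated (B : algebra S) X (e : X -> B) (x0 : X) : algebra S :=
  @Algebra S (subalgebra_carrier e) (fun f a => exist _ _ (generated_closed a))
    (inhabits (exist _ (e x0) (ex_intro _ (Var S x0) erefl))).

Lemma eval_generated (B : algebra S) X (e : X -> B) x0 Y
    (g : Y -> generated e x0) t : sval (eval g t) = eval (fun y => sval (g y)) t.
Proof. by elim: t => //= f ts IH; congr (op _); apply/funext. Qed.

Lemma generated_in (W : set (algebra S)) (B : algebra S) X (e : X -> B) x0 :
  is_variety W -> W B -> W (generated e x0).
Proof.
case=> Phi -> WB st /WB h g.
by apply: eq_sig_hprop => [b|]; [exact: Prop_irrelevance|rewrite !eval_generated].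
Qed.

Lemma product_inhabited (I : Type) (B : I -> algebra S) :
  inhabited (forall i, B i).
Proof.
have BP i : exists b : B i, True by case: (carrier_inhabited (B i)) => b; exists b.
by split=> i; have [b _] := cid (BP i).
Qed.

Definition product (I : Type) (B : I -> algebra S) : algebra S :=
  @Algebra S (forall i, B i) (fun f a i => op (fun j => a j i))
    (product_inhabited B).

Lemma eval_product (I : Type) (B : I -> algebra S) X (e : X -> product B) t i :
  eval e t i = eval (fun x => e x i) t.
Proof. by elim: t => //= f ts IH; congr (op _); apply/funext. Qed.

Lemma product_in (W : set (algebra S)) (I : Type) (B : I -> algebra S) :
  is_variety W -> (forall i, W (B i)) -> W (product B).
Proof.
case=> Phi -> WB st Phist e; apply: functional_extensionality_dep => i.
by rewrite !eval_product; apply: (WB i).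
Qed.

Definition one_algebra : algebra S :=
  @Algebra S unit (fun _ _ => tt) (inhabits tt).

Lemma one_algebra_in (W : set (algebra S)) : is_variety W -> W one_algebra.
Proof. by case=> Phi -> st _ e; case: (eval _ _); case: (eval _ _). Qed.

Definition kernel (B : algebra S) X (e : X -> B) : set (term S X * term S X) :=
  [set uv | eval e uv.1 = eval e uv.2].

Lemma isomorphic_models (B C : algebra S) st :
  isomorphic B C -> satisfies B st -> satisfies C st.
Proof.
case=> h [h' hK h'K] hom Bst e.
have ev (t : term S nat) : eval e t = h (eval (h' \o e) t).
  elim: t => [x|f ts IH] /=; first by rewrite h'K.
  by rewrite hom; congr (op _); apply/funext.
by rewrite !ev Bst.
Qed.

Lemma isomorphic_in (W : set (algebra S)) (B C : algebra S) : is_variety W ->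
  isomorphic B C -> W B -> W C.
Proof. by case=> Phi -> BC WB st /WB; apply: isomorphic_models. Qed.

Lemma isomorphic_sym (B C : algebra S) : isomorphic B C -> isomorphic C B.
Proof.
case=> h [h' hK h'K] hom; exists h'; first by exists h.
move=> f a; rewrite -[RHS]hK hom; congr (h' (op _)).
by apply/funext => i; rewrite h'K.
Qed.

(** An algebra is the quotient of a term algebra by the kernel of the evaluation
at a generating family. *)
Lemma kernel_isomorphic (B C : algebra S) X (d : X -> B) (e : X -> C) :
  (forall b, exists t, b = eval d t) -> (forall c, exists t, c = eval e t) ->
  kernel d = kernel e -> isomorphic B C.
Proof.
move=> tbP tcP de; have [tb {}tbP] := choice tbP; have [tc {}tcP] := choice tcP.
have deE s t : eval d s = eval d t <-> eval e s = eval e t.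
  by have := congr1 (fun K => K (s, t)) de; rewrite /kernel /= => ->.
exists (fun b => eval e (tb b)).
  exists (fun c => eval d (tc c)) => [b|c].
    by rewrite [RHS]tbP; apply/deE; rewrite -tcP.
  by rewrite [RHS]tcP; apply/deE; rewrite -tbP.
move=> f a; transitivity (eval e (App (fun i => tb (a i)))) => //.
by apply/deE; rewrite -tbP /=; congr (op _); apply/funext.
Qed.
End Terms.

(** * Locally finite varieties *)

(** The finite algebra [A] is coded on ['I_l], so that its [n]-ary term functions
become elements of the finite type [table n]. *)
Section LocallyFinite.
Variables (S : signature) (A : algebra S) (l : nat).
Variables (dec : 'I_l -> A) (cod : A -> 'I_l).
Hypothesis codK : cancel cod dec.
Local Notation V := (var_gen [set A]).

Definition table n : finType := {ffun n.-tuple 'I_l -> 'I_l}.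

Definition table_of n (t : term S 'I_n) : table n :=
  [ffun w => cod (eval (fun i => dec (tnth w i)) t)].

Lemma table_ofP n (s t : term S 'I_n) :
  table_of s = table_of t <-> holds V s t.
Proof.
split=> [st|h]; last by apply/ffunP => w; rewrite !ffunE (h A) //; apply: sub_var_gen.
apply: holds_var_gen => _ -> e; apply: (can_inj codK).
have /ffunP/(_ [tuple cod (e i) | i < n]) := st; rewrite !ffunE.
by rewrite (_ : (fun i => _) = e) //; apply/funext => i; rewrite tnth_mktuple codK.
Qed.

(** Relations between terms that are compatible with the identities of [V] are
relations between term functions of [A]; [code] makes them elements of a finite
type, without loss by code_inj. *)
Definition code n (P : term S 'I_n -> term S 'I_n -> Prop) :
    {ffun table n * table n -> bool} :=
  [ffun pq => `[< exists s t, [/\ table_of s = pq.1, table_of t = pq.2 & P s t] >]].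

Lemma code_inj n (P Q : term S 'I_n -> term S 'I_n -> Prop) :
  (forall s s' t t', holds V s s' -> holds V t t' -> Q s t -> Q s' t') ->
  code P = code Q -> forall s t, P s t -> Q s t.
Proof.
move=> QV /ffunP/(_ (_, _)) PQ s t Pst; have := PQ (table_of s) (table_of t).
rewrite !ffunE; case: asboolP => [_|[]]; last by exists s, t.
move/esym/asboolP => [s' [t' /= [/table_ofP ss /table_ofP tt]]]; exact: QV.
Qed.

Lemma eval_resp n (B : algebra S) (e : 'I_n -> B) : V B ->
  forall s s' t t', holds V s s' -> holds V t t' ->
  eval e s = eval e t -> eval e s' = eval e t'.
Proof. by move=> VB s s' t t' ss tt; rewrite (ss B) // (tt B). Qed.

Lemma holds_resp n (W : set (algebra S)) : W `<=` V ->
  forall s s' t t' : term S 'I_n, holds V s s' -> holds V t t' ->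
  holds W s t -> holds W s' t'.
Proof.
move=> WV s s' t t' ss tt h B WB e.
exact: (eval_resp (WV _ WB)) (h _ WB _).
Qed.

Definition kernel_code n (B : algebra S) (e : 'I_n -> B) :=
  code (fun s t => eval e s = eval e t).

Lemma kernel_code_isomorphic n (B C : algebra S) (d : 'I_n -> B) (e : 'I_n -> C) :
  V B -> V C ->
  (forall b, exists t, b = eval d t) -> (forall c, exists t, c = eval e t) ->
  kernel_code d = kernel_code e -> isomorphic B C.
Proof.
move=> VB VC dB eC de; apply: kernel_isomorphic dB eC _.
apply/seteqP; split=> -[s t]; rewrite /kernel /=.
  by move: s t; apply: code_inj de; apply: eval_resp.
by move: s t; apply: code_inj (esym de); apply: eval_resp.
Qed.

Lemma generated_finite n (B : algebra S) (e : 'I_n -> B) :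
  V B -> (forall b, exists t, b = eval e t) -> finite_algebra B.
Proof.
move=> VB eB; have [b0] := carrier_inhabited B.
have H (p : table n) : exists b, forall t, table_of t = p -> b = eval e t.
  have [[t <-]|no] := pselect (exists t, table_of t = p).
    by exists (eval e t) => t' /table_ofP/(_ _ VB).
  by exists b0 => t tp; case: no; exists t.
have [g gP] := choice H.
apply: (@sub_finite_set _ _ (range g)); last exact/finite_image/finite_finset.
by move=> b _; have [t ->] := eB b; exists (table_of t) => //; apply: gP.
Qed.

(** The values of the variables where the identity fails generate a small
subalgebra. *)
Lemma finite_counterexample (W : set (algebra S)) n (s t : term S 'I_n.+1) :
  is_variety W -> W `<=` V -> ~ holds W s t ->
  exists (C : algebra S) (e : 'I_n.+1 -> C),
    [/\ W C, eval e s <> eval e t & forall c, exists t, c = eval e t].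
Proof.
move=> vW WV /existsNP[B /not_implyP[WB /existsNP[e est]]].
pose g i : generated e ord0 := exist _ (e i) (ex_intro _ (Var S i) erefl).
exists (generated e ord0), g; split; first exact: generated_in.
  by move=> /(congr1 sval); rewrite !eval_generated.
case=> b [u bu]; exists u; apply: eq_sig_hprop => [c|]; first exact: Prop_irrelevance.
by rewrite eval_generated.
Qed.

(** If an identity in [n.+1] variables fails in all members of the chain, each
member contains a counterexample generated by [n.+1] elements. There are
finitely many of these up to isomorphism, so one occurs infinitely often, and
it lies in the intersection. *)
Lemma chain_compact (W : nat -> set (algebra S)) st :
  (forall i, subvariety V (W i)) -> (forall i j, i <= j -> W j `<=` W i) ->
  theory (\bigcap_i W i) st -> exists i, theory (W i) st.
Proof.
move=> WV Wmono; have [n [s [t ->]]] := finite_vars2 st.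
rewrite /theory /= holds_val => h.
apply: contrapT => /forallNP no.
have H i : exists Ce : {C : algebra S & 'I_n.+1 -> C}, let e := projT2 Ce in
    [/\ W i (projT1 Ce), eval e s <> eval e t & forall c, exists t, c = eval e t].
  have [vW WiV] := WV i.
  have [|C [e HC]] := finite_counterexample vW WiV (s := s) (t := t).
    by rewrite -holds_val; apply: no.
  by exists (existT _ C e).
have [g gP] := choice H.
have [c cP] := infinite_pigeonhole (fun i => kernel_code (projT2 (g i))).
have [m _ mc] := cP 0; have [Wm nst gm] := gP m.
have VW i B : W i B -> V B by apply: (WV i).2.
apply/nst/h => i _; have [j ij jc] := cP i; have [Wj _ gj] := gP j.
apply: (@isomorphic_in S _ (projT1 (g j))); first exact: (WV i).1.
  apply: kernel_code_isomorphic gj gm _; [exact: VW Wj|exact: VW Wm|].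
  by rewrite jc mc.
exact: Wmono Wj.
Qed.

(** One identity for each pair of term functions of [A] suffices. *)
Lemma theory_from_finite n (U : set (algebra S)) : U `<=` V ->
  exists Phi, [/\ finite_set Phi, Phi `<=` theory_from n U &
    V `&` models Phi `<=` models (theory_from n U)].
Proof.
move=> UV; pose x0 : term S 'I_n.+1 := Var S ord0.
pose P (pq : table n.+1 * table n.+1) s t :=
  [/\ table_of s = pq.1, table_of t = pq.2 & holds U s t].
have H (pq : table n.+1 * table n.+1) : exists uv : term S 'I_n.+1 * term S 'I_n.+1,
    holds U uv.1 uv.2 /\ ((exists s t, P pq s t) -> P pq uv.1 uv.2).
  have [[s [t Pst]]|no] := pselect (exists s t, P pq s t); last by exists (x0, x0).
  by exists (s, t); split=> //; case: Pst.
have [E EP] := choice H; pose idE pq := (rename val (E pq).1, rename val (E pq).2).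
exists (range idE); split; first exact/finite_image/finite_finset.
  by move=> _ [pq _ <-]; exists (E pq) => //; apply: (EP pq).1.
move=> C [VC h] _ [[s t] /= hst ->]; pose pq := (table_of s, table_of t).
have [|/table_ofP ss /table_ofP tt _] := (EP pq).2; first by exists s, t.
move=> e; rewrite /= !eval_rename -(ss C) // -(tt C) //.
by have := h _ (imageT idE pq) e; rewrite /= !eval_rename.
Qed.

(** Modulo [V] there are countably many identities, even over an uncountable
signature. *)
Lemma countable_identities : exists E : nat -> identity S, forall st, exists n,
  forall K, K `<=` V -> (theory K st <-> theory K (E n)).
Proof.
have H n (pq : table n.+1 * table n.+1) : exists st : identity S,
    forall s t, table_of s = pq.1 -> table_of t = pq.2 ->
    forall K, K `<=` V -> (theory K (rename val s, rename val t) <-> theory K st).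
  have [[s [t [sp tq]]]|no] := pselect (exists (s t : term S 'I_n.+1),
      table_of s = pq.1 /\ table_of t = pq.2); last first.
    by exists (Var S 0, Var S 0) => s t sp tq; case: no; exists s, t.
  exists (rename val s, rename val t) => s' t' sp' tq' K KV.
  rewrite /theory /= !holds_val.
  have/table_ofP ss : table_of s = table_of s' by rewrite sp.
  have/table_ofP tt : table_of t = table_of t' by rewrite tq.
  have/table_ofP ss' : table_of s' = table_of s by rewrite sp.
  have/table_ofP tt' : table_of t' = table_of t by rewrite tq.
  by split; apply: holds_resp.
have [E EP] := choice (fun x : {n : nat & (table n.+1 * table n.+1)%type} =>
  H (tag x) (tagged x)).
exists (fun k => oapp E (Var S 0, Var S 0) (unpickle k)) => st.
have [n [s [t ->]]] := finite_vars2 st.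
pose x : {n : nat & (table n.+1 * table n.+1)%type} :=
  Tagged (fun n => (table n.+1 * table n.+1)%type) (table_of s, table_of t).
exists (pickle x) => K; rewrite pickleK /=; exact: (EP x s t erefl erefl).
Qed.

(** The product of one counterexample for each failing identity. The product is
taken over natural numbers by means of countable_identities: the type of all
identities lives in too large a universe to index a product of algebras. *)
Lemma variety_single (W : set (algebra S)) : subvariety V W ->
  exists2 B, W B & W = var_gen [set B].
Proof.
move=> [vW WV]; have [E EP] := countable_identities.
have H n : exists B, W B /\ (~ theory W (E n) -> ~ satisfies B (E n)).
  have [h|] := pselect (theory W (E n)).
    by exists (one_algebra S); split=> //; apply: one_algebra_in.
  move=> /existsNP[B /not_implyP[WB nB]]; exists B; split=> // _; exact: nB.
have [B BP] := choice H; have WB : W (product B).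
  by apply: product_in => // n; apply: (BP n).1.
have BW : var_gen [set product B] `<=` W by apply: var_gen_sub => // _ ->.
exists (product B) => //; apply/seteqP; split=> //.
apply: theory_sub; first exact: is_variety_var_gen.
move=> st; have [n nP] := EP st; rewrite !nP // => [h|C /BW/WV//].
apply: contrapT => /(BP n).2; apply=> e.
have [b0] := carrier_inhabited (product B).
(* [e] on the [n]-th factor, extended in an arbitrary way to the others. *)
pose e' x : product B := fun i => if pselect (n = i) is left p
  then ecast i (B i) p (e x) else b0 i.
have := h (product B) (sub_var_gen erefl) e' => /(congr1 (fun g => g n)).
rewrite !eval_product (_ : (fun x => e' x n) = e) //; apply/funext => x.
by rewrite /e'; case: pselect => // p; rewrite eq_axiomK.
Qed.

End LocallyFinite.

(** * The equivalences *)

Lemma finite_coding (T : Type) : finite_set [set: T] -> inhabited T ->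
  exists l (dec : 'I_l -> T) (cod : T -> 'I_l),
    0 < l /\ cancel cod dec.
Proof.
elim/Pchoice: T => T /finite_seqP[s sE] [x0].
have sP x : x \in s by have : [set` s] x by rewrite -sE.
pose u := undup s; have uP x : x \in u by rewrite mem_undup.
have iu x : index x u < size u by rewrite index_mem.
exists (size u), (tnth (in_tuple u)), (fun x => Ordinal (iu x)); split.
  exact: leq_trans (iu x0).
by move=> x; rewrite (tnth_nth x0) /= nth_index.
Qed.

Section FiniteDetermination.
Variables (S : signature) (A : algebra S).
Hypotheses (finA : finite_algebra A) (edgeA : has_edge_term A).
Local Notation V := (var_gen [set A]).

(** The pairs of term functions induced by the identities of [W] form a clonoid
from ['I_l], a copy of [A], to [A * A]. *)
Lemma finitely_determined (W : set (algebra S)) : W `<=` V ->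
  exists n, forall m (s t : term S 'I_m.+1),
    (forall sigma : 'I_m.+1 -> 'I_n, holds W (rename sigma s) (rename sigma t)) ->
    holds W s t.
Proof.
move=> WV; have [l [dec [cod [l0 codK]]]] := finite_coding finA (carrier_inhabited A).
have [k k2 [t edge_t]] := edgeA.
pose fn m (st : term S 'I_m * term S 'I_m) (w : m.-tuple 'I_l) : A * A :=
  (eval (dec \o tnth w) st.1, eval (dec \o tnth w) st.2).
pose C m : set (m.-tuple 'I_l -> A * A) :=
  [set f | exists2 st, holds W st.1 st.2 & f = fn m st].
pose t2 (F : 'I_k.+1 -> A * A) := (eval (fst \o F) t, eval (snd \o F) t).
have edge_t2 : edge_operation t2.
  move=> x y; have [h1 h2 h3] := edge_t x.1 y.1; have [h1' h2' h3'] := edge_t x.2 y.2.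
  rewrite /t2; split=> [||i i3]; rewrite [RHS]surjective_pairing; congr (_, _).
  - by rewrite -[RHS]h1; congr (eval _ _); apply/funext => j /=; case: ifP.
  - by rewrite -[RHS]h1'; congr (eval _ _); apply/funext => j /=; case: ifP.
  - by rewrite -[RHS]h2; congr (eval _ _); apply/funext => j /=; case: ifP.
  - by rewrite -[RHS]h2'; congr (eval _ _); apply/funext => j /=; case: ifP.
  - by rewrite -[RHS](h3 i i3); congr (eval _ _); apply/funext => j /=; case: ifP.
  - by rewrite -[RHS](h3' i i3); congr (eval _ _); apply/funext => j /=; case: ifP.
have CC : clonoid t2 C.
  split=> [m F FC|m n sigma _ [st hst ->]].
    have H j : exists st, holds W st.1 st.2 /\ F j = fn m st.
      by have [st] := FC j; exists st.
    have [st stP] := choice H.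
    exists (subst (fun j => (st j).1) t, subst (fun j => (st j).2) t) => [B WB e|].
      rewrite !eval_subst; congr (eval _ _); apply/funext => j.
      exact: ((stP j).1 B WB e).
    apply/funext => w; rewrite /fn /t2 /= !eval_subst.
    by congr (_, _); congr (eval _ _); apply/funext => j /=; rewrite (stP j).2.
  exists (rename sigma st.1, rename sigma st.2); first exact: holds_rename.
  apply/funext => w; rewrite /fn /= !eval_rename.
  by congr (_, _); congr (eval _ _); apply/funext => j /=; rewrite tnth_mktuple.
have finAA : finite_set [set: A * A] by rewrite -setXTT; apply: finite_setX.
have [n nP] := clonoid_finitely_related l0 k2 edge_t2 finAA CC.
exists n => m s s' h.
have [|[u u'] huu' E] := nP m.+1 (fn _ (s, s')) isT.
  move=> sigma; exists (rename sigma s, rename sigma s'); first exact: h.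
  apply/funext => w; rewrite /fn /= !eval_rename.
  by congr (_, _); congr (eval _ _); apply/funext => j /=; rewrite tnth_mktuple.
have E' w := congr1 (fun g => g w) E.
have su : holds V u s.
  apply/(table_ofP codK); apply/ffunP => w; rewrite !ffunE; congr cod.
  by have [-> _] := E' w.
have su' : holds V u' s'.
  apply/(table_ofP codK); apply/ffunP => w; rewrite !ffunE; congr cod.
  by have [_ ->] := E' w.
exact: holds_resp su su' huu'.
Qed.

End FiniteDetermination.

Section Implications.
Variables (S : signature) (A : algebra S).
Hypotheses (finA : finite_algebra A).
Local Notation V := (var_gen [set A]).

Let vV : is_variety V := is_variety_var_gen _.

(** With [n] as in finitely_determined, a subvariety [U] of [W] that has the same
[n]-variable identities, [prof U = prof W], is equal to [W]. The others are
distributed over the finitely many joins [J E]. The join of varieties with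
[n]-variable identities [E] has again [n]-variable identities [E], so it is
different from [W]. *)
Lemma infinite_proper_subvariety (edgeA : has_edge_term A) (W : set (algebra S)) :
  subvariety V W -> infinite_set (subvariety W) ->
  exists J, [/\ subvariety V J, J `<` W & infinite_set (subvariety J)].
Proof.
move=> [vW WV] infW.
have [l [dec [cod [_ codK]]]] := finite_coding finA (carrier_inhabited A).
have [n nP] := finitely_determined finA edgeA WV.
pose prof U := code dec cod (@holds S U 'I_n).
have profP U U' : U `<=` V -> U' `<=` V -> prof U = prof U' ->
    forall s t : term S 'I_n, holds U s t -> holds U' s t.
  by move=> UV U'V; apply: (code_inj codK); apply: holds_resp.
pose Sub E := [set U | subvariety W U /\ prof U = E].
pose J E := var_gen (\bigcup_(U in Sub E) U).
have JW E : J E `<=` W by apply: var_gen_sub => // B [U [[_ UW] _] /UW].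
apply: contrapT => /forallNP noJ; apply: infW.
pose D := [set E | E <> prof W /\ exists U, Sub E U].
apply: (@sub_finite_set _ _ ([set W] `|` \bigcup_(E in D) subvariety (J E))).
  move=> U [vU UW]; have [UWp|UWp] := pselect (prof U = prof W).
    left; apply/seteqP; split=> //; apply: fintheory_sub => // m s t hU.
    apply: nP => sigma; apply: (profP _ _ _ _ UWp) => //.
      exact: subset_trans WV.
    exact: holds_rename.
  right; exists (prof U); first by split=> //; exists U.
  by split=> // B UB; apply: sub_var_gen; exists U.
rewrite finite_setU; split; first exact: finite_set1.
apply: bigcup_finite => [|E [EW [U [[vU UW] UE]]]]; first exact: finite_finset.
apply: contrapT => infJ; apply: (noJ (J E)); split=> //.
  by split; [exact: is_variety_var_gen|exact: subset_trans WV].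
split=> // WJ; apply: EW; rewrite -UE; apply/ffunP => pq; rewrite !ffunE.
apply: asbool_equiv_eq; split=> -[s [t [sp tq h]]]; exists s, t; split=> //.
  apply: (holds_sub WJ); apply: holds_var_gen => B [U' [[_ U'W] U'E] U'B].
  have {}h := profP U U' (subset_trans UW WV) (subset_trans U'W WV) _ _ _ h.
  by apply: h => //; rewrite UE.
exact: holds_sub h.
Qed.

Lemma dcc_finite (edgeA : has_edge_term A) :
  (~ exists W, infinite_descending_chain V W) -> finite_set (subvariety V).
Proof.
move=> dcc; apply: contrapT => infV; apply: dcc.
pose Q W := subvariety V W /\ infinite_set (subvariety W).
have H (W : {W | Q W}) : exists W' : {W | Q W}, sval W' `<` sval W.
  have [J [VJ JW infJ]] := infinite_proper_subvariety edgeA (svalP W).1 (svalP W).2.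
  by exists (exist Q J (conj VJ infJ)).
have [next nextP] := choice H.
have QV : Q V by split => //; split.
pose W n := iter n next (exist Q V QV).
by exists (fun n => sval (W n)); split=> n; [exact: (svalP (W n)).1|apply: nextP].
Qed.

Lemma descending_chain_le (W : nat -> set (algebra S)) :
  (forall n, W n.+1 `<` W n) -> forall i j, i <= j -> W j `<=` W i.
Proof.
move=> Wlt i j ij; rewrite -(subnKC ij); elim: (j - i) => [|d IH].
  by rewrite addn0.
by rewrite addnS; apply: subset_trans IH; apply: (Wlt _).1.
Qed.

(** The intersection of the chain is generated by one algebra [B]. All identities
of a finite base of [B] relative to [V] hold from some member of the chain on,
so the chain stops there. *)
Lemma based_dcc :
  (forall B, V B -> alg_rel_finitely_based V B) ->
  ~ exists W, infinite_descending_chain V W.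
Proof.
move=> fb [W [WV Wlt]].
have [l [dec [cod [_ codK]]]] := finite_coding finA (carrier_inhabited A).
have Wmono := descending_chain_le Wlt.
have [|B WB WE] := variety_single codK (W := \bigcap_i W i).
  split; first by apply: is_variety_bigcap => i; apply: (WV i).1.
  by move=> C /(_ 0 I) /(WV 0).2.
have VB : V B by apply: (WV 0).2; apply: WB.
have [Phi finPhi PhiE] := fb B VB.
have [||n nP] := @finite_uniform _ Phi (fun st n => theory (W n) st) finPhi.
- by move=> st i j ij h C /(Wmono _ _ ij); apply: h.
- move=> st Phist; apply: (chain_compact codK WV Wmono) => C.
  by rewrite WE PhiE => -[_ /(_ st Phist)].
have [_ []] := Wlt n => C WC.
suff : (\bigcap_i W i) C by apply.
rewrite WE PhiE; split; first exact: (WV n).2.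
by move=> st Phist e; apply: (nP st Phist C WC).
Qed.

(** [W n] is defined in [V] by the identities of [B] in the first [n.+1]
variables. Every identity has finitely many variables, so the [W n] decrease to
the variety generated by [B]. *)
Lemma dcc_based :
  (~ exists W, infinite_descending_chain V W) ->
  forall B, V B -> alg_rel_finitely_based V B.
Proof.
move=> dcc B VB.
have [l [dec [cod [_ codK]]]] := finite_coding finA (carrier_inhabited A).
set U := var_gen [set B].
have UV : U `<=` V by apply: var_gen_sub => // _ ->.
pose W n := V `&` models (theory_from n U).
have WV n : subvariety V (W n).
  by split; [exact: is_varietyI|move=> C []].
have Wmono n m : n <= m -> W m `<=` W n.
  move=> nm C [VC h]; split=> // _ [[s t] /= hst ->]; apply: h.
  have nm' : n < m.+1 by [].
  exists (rename (widen_ord nm') s, rename (widen_ord nm') t).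
    exact: holds_rename.
  by rewrite !rename_comp.
have UW n : U `<=` W n.
  move=> C UC; split; first exact: UV.
  by move=> _ [[s t] /= /holds_val h ->] e; apply: (h C).
have [n nP] : exists n, forall m, n <= m -> W n `<=` W m.
  apply: contrapT => /forallNP H; apply: dcc.
  have {}H n : exists m, W m `<` W n.
    have /existsNP[m /not_implyP[nm Wnm]] := H n; exists m; split=> //.
    exact: Wmono.
  have [next nextP] := choice H.
  by exists (fun i => W (iter i next 0)); split=> i //=; apply: nextP.
have WU : W n = U.
  apply/seteqP; split=> //; apply: fintheory_sub; first exact: is_variety_var_gen.
  move=> m s t hst C /(nP _ (leq_maxl n m)) /(Wmono _ _ (leq_maxr n m))[_ h].
  have hC : holds [set C] (rename val s) (rename val t).
    by move=> _ -> e; apply: (h (_, _)); exists (s, t).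
  by apply: ((holds_val _ _ _).1 hC).
have [Phi [finPhi PhiU VPhi]] := theory_from_finite codK n UV.
exists Phi => //; rewrite -/U; apply/seteqP; split=> C.
  by rewrite -WU => -[VC h]; split=> // st /PhiU/h.
by move=> CPhi; rewrite -WU; split; [case: CPhi|apply: VPhi].
Qed.

Lemma smaller_size (B C : algebra S) m n :
  [set: C] #= `I_m -> [set: B] #= `I_n -> smaller C B <-> m < n.
Proof.
move=> Cm Bn; rewrite /smaller (card_le_eql Cm) (card_le_eqr Bn) card_le_II
  (card_eql Cm) (card_eqr Bn).
split=> [[mn /card_eq_II/eqP ne]|mn]; first by rewrite ltn_neqAle ne.
split; first exact: ltnW.
by apply/card_eq_II => e; rewrite e ltnn in mn.
Qed.

Lemma size_enum (T : Type) n N : inhabited T -> [set: T] #= `I_n -> n <= N ->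
  exists d : 'I_N -> T, forall x, exists i, x = d i.
Proof.
case=> x0 /card_eqPle[Tn _] nN.
have {}Tn : [set: T] #<= `I_N by apply: card_le_trans Tn _; rewrite card_le_II.
elim/Ppointed: T x0 Tn => T x0 Tn.
  by have := I : [set: T] x0; rewrite emptyE.
have [g gT] := pcard_surjP Tn; exists (g \o val) => x.
by have [i iN <-] := gT x I; exists (Ordinal iN).
Qed.

(** An enumeration by ['I_N] is a generating family, and its kernel determines
the algebra. *)
Lemma finite_up_to_iso_bounded (K : set (algebra S)) N : K `<=` V ->
  (forall B, K B -> exists d : 'I_N -> B, forall b, exists i, b = d i) ->
  finite_up_to_iso K.
Proof.
move=> KV Kd.
have [l [dec [cod [_ codK]]]] := finite_coding finA (carrier_inhabited A).
pose P c (B : algebra S) := K B /\ exists2 d : 'I_N -> B,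
  (forall b, exists i, b = d i) & kernel_code dec cod d = c.
have H c : exists B, (exists B', P c B') -> P c B.
  by have [[B PB]|] := pselect (exists B', P c B'); [exists B|exists A].
have [rep repP] := choice H.
exists (rep @` [set c | exists B, P c B]); split.
- exact/finite_image/finite_finset.
- by move=> _ [c /repP[KB _] <-].
move=> B KB; have [d dB] := Kd B KB.
have Pd : exists B', P (kernel_code dec cod d) B' by exists B; split=> //; exists d.
exists (rep (kernel_code dec cod d)); first by exists (kernel_code dec cod d).
have [KR [e eR ed]] := repP _ Pd.
apply: (kernel_code_isomorphic codK (d := d) (e := e)) => //.
- exact: KV.
- exact: KV.
- by move=> b; have [i ->] := dB b; exists (Var S i).
- by move=> b; have [i ->] := eR b; exists (Var S i).
Qed.

(** If two critical algebras generate the same variety, neither is smaller than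
the other: the larger one would lie in the variety generated by the smaller one,
against criticality. So the finitely many subvarieties bound the sizes. *)
Lemma finite_critical : finite_set (subvariety V) ->
  finite_up_to_iso (V `&` @cardinality_critical S).
Proof.
move=> finV.
have [||N NP] := @finite_uniform _ (subvariety V) (fun W N => forall B,
  cardinality_critical B -> var_gen [set B] = W ->
  exists d : 'I_N -> B, forall b, exists i, b = d i) finV.
- move=> W m n mn H B critB BW; have [d dB] := H B critB BW.
  have [b0] := carrier_inhabited B.
  exists (fun i => oapp d b0 (insub (val i))) => b; have [i ->] := dB b.
  by exists (widen_ord mn i); rewrite /= valK.
- move=> W _.
  have [[B0 [crit0 W0]]|no] := pselect (exists B,
      cardinality_critical B /\ var_gen [set B] = W);
    last by exists 0 => B cB BW; case: no; exists B.
  have /finite_setP[n0 sz0] := crit0.1; exists n0 => B critB BW.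
  have /finite_setP[n sz] := critB.1.
  apply: (size_enum (carrier_inhabited B) sz); rewrite leqNgt; apply/negP => nn.
  apply: critB.2; have : var_gen [set B0] B by rewrite W0 -BW; apply: sub_var_gen.
  apply: var_gen_sub; first exact: is_variety_var_gen.
  move=> _ ->; apply: sub_var_gen; split; last exact/(smaller_size sz0 sz).
  by rewrite BW -W0; apply: sub_var_gen.
apply: (@finite_up_to_iso_bounded _ N); first by move=> B [].
move=> B [VB critB]; apply: (NP (var_gen [set B])) => //.
by split; [exact: is_variety_var_gen|apply: var_gen_sub => // _ ->].
Qed.

(** Induction on the size: if [B] is not critical, it is generated by smaller
members of the variety that it generates. *)
Lemma finite_in_critical (W : set (algebra S)) : is_variety W ->
  forall B, finite_algebra B -> W B -> var_gen (W `&` @cardinality_critical S) B.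
Proof.
move=> vW B finB WB; have /finite_setP[n] := finB.
have [N] := ubnP n; elim: N n B finB WB => // N IH n B finB WB nN sz.
have [critB|ncrit] := pselect (cardinality_critical B).
  exact: sub_var_gen.
have : var_gen [set C | var_gen [set B] C /\ smaller C B] B.
  by apply: contrapT => nB; apply: ncrit.
apply: var_gen_sub; first exact: is_variety_var_gen.
move=> C [BC CB]; have finC : finite_algebra C by apply: card_le_finite CB.1 _.
have /finite_setP[m szC] := finC; have /(smaller_size szC sz) mn := CB.
apply: (IH m) => //; last by rewrite (leq_trans mn).
by apply: var_gen_sub BC => // _ ->.
Qed.

Lemma critical_generate (W : set (algebra S)) : subvariety V W ->
  W = var_gen (W `&` @cardinality_critical S).
Proof.
move=> [vW WV]; apply/seteqP; split; last by apply: var_gen_sub => // B [].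
have [l [dec [cod [_ codK]]]] := finite_coding finA (carrier_inhabited A).
apply: fintheory_sub; first exact: is_variety_var_gen.
move=> n s t h; apply: contrapT => /(finite_counterexample vW WV)[C [e [WC est eC]]].
apply: est; apply: (h C); apply: finite_in_critical => //.
by apply: (generated_finite codK) eC; apply: WV.
Qed.

(** Two members of a chain that contain the same representatives of critical
algebras are equal, and there are finitely many sets of representatives. *)
Lemma finite_critical_dcc :
  finite_up_to_iso (V `&` @cardinality_critical S) ->
  ~ exists W, infinite_descending_chain V W.
Proof.
move=> [F [finF FV FP]] [W [WV Wlt]].
have Wmono := descending_chain_le Wlt.
have [N [d dE]] := finite_range finF; subst F.
have [c cP] := infinite_pigeonhole (fun n => [ffun i => `[< W n (d i) >]]).
have [n _ nc] := cP 0; have [m nm mc] := cP n.+1.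
have [_ []] := Wlt n; apply: subset_trans (Wmono _ _ nm).
rewrite {1}(critical_generate (WV n)); apply: var_gen_sub; first exact: (WV m).1.
move=> B [WB critB]; have VB := (WV n).2 _ WB.
have [_ [i _ <-] Bi] := FP B (conj VB critB).
apply: (isomorphic_in (WV m).1 (isomorphic_sym Bi)).
have /ffunP/(_ i) : [ffun i => `[< W n (d i) >]] = [ffun i => `[< W m (d i) >]].
  by rewrite nc mc.
rewrite !ffunE => e; apply/asboolP; rewrite -e; apply/asboolP.
exact: isomorphic_in (WV n).1 Bi WB.
Qed.

End Implications.

Theorem corollary1p5 (S : signature) (A : algebra S)
  (finA : finite_algebra A) (edgeA : has_edge_term A) :
  [<-> forall B : algebra S, var_gen [set A] B ->
         alg_rel_finitely_based (var_gen [set A]) B;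
       finite_set (subvariety (var_gen [set A]));
       finite_up_to_iso (var_gen [set A] `&` @cardinality_critical S);
       ~ exists W : nat -> set (algebra S),
           infinite_descending_chain (var_gen [set A]) W].
Proof.
tfae.
- by move=> /(based_dcc finA)/(dcc_finite finA edgeA).
- exact: finite_critical.
- exact: finite_critical_dcc.
- exact: dcc_based.
Qed.
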